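(* For any grid diagram $G$ with associated oriented Legendrian link $\vec{\mathcal L}$ (with $\ell$ components), the homology classes $\lambda^+(\vec{\mathcal L})$ and $\lambda^-(\vec{\mathcal L})$ in $H_*(\mathit{CL}^-(G))$ are nonzero and are not $U_i$-torsion for any $i$; i.e. $U_i^d\lambda^\pm(\vec{\mathcal L})\neq0$ for all $i$ and all $d\ge0$.
   Context: A (planar) grid diagram $G$ of grid number $n$ is an $n\times n$ array of unit squares, some marked $X$ and some $O$ (labelled $O_1,\dots,O_n$), with exactly one $X$ and one $O$ (in different squares) in every row and column; horizontal segments $O\to X$ and vertical segments $X\to O$ (verticals over) give an oriented link diagram. $\mathbf S(G)$ is the set of $n$-tuples of intersection points of the horizontal and vertical grid circles of the torus with one point on each circle. $\mathit{CL}^-(G)$ is the free $\mathbb Z[U_1,\dots,U_n]$-module on $\mathbf S(G)$ whose differential counts, with signs from a fixed sign assignment and weight $\prod U_i^{O_i(r)}$ ($O_i(r)$ the multiplicity of $O_i$ in $r$), the empty rectangles $r\subset T^2$ from $\mathbf x$ to $\mathbf y$ containing no $X$. The oriented Legendrian link of $G$ has front obtained from the planar diagram by smoothing northwest and southeast corners, making southwest and northeast corners cusps, and rotating $45^\circ$ clockwise. $\mathbf x^+(G)$ (resp. $\mathbf x^-(G)$) is the generator whose points are the upper right (resp. lower left) corners of the squares marked $X$; these are cycles and $\lambda^\pm(\vec{\mathcal L})$ denote their homology classes (up to sign). *)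

(* Defs.v *)
From mathcomp Require Import all_boot all_order all_algebra all_fingroup.
From mathcomp Require Import mpoly.
Set Implicit Arguments. Unset Strict Implicit. Unset Printing Implicit Defensive.
Import GRing.Theory.
Local Open Scope ring_scope.

(* Conventions.  A grid diagram of grid number n is given by two          *)
(* permutations sX sO of 'I_n: in column c (c = 0..n-1, left to right) the *)
(* X-marked square is in row sX c and the O-marked square in row sO c     *)
(* (rows 0..n-1 bottom to top).  "One X and one O per row and column" is  *)
(* bijectivity; "in different squares" is  forall c, sX c != sO c.        *)
(* The O in column i is labelled O_i.                                      *)
(* On the torus, the vertical circles are the lines x = k, horizontal     *)
(* circles y = k (k in 'I_n); the square (c, r) is [c,c+1] x [r,r+1].      *)
(* A generator x in S(G) is a permutation: its point on vertical circle c *)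
(* is the lattice point (c, x c).                                          *)

Definition gen (n : nat) := {perm 'I_n}.

Definition cyc_in n (a b k : 'I_n) : bool :=
  ((k + n - a) %% n < (b + n - a) %% n)%N.
Definition cyc_open n (a b k : 'I_n) : bool :=
  (0 < (k + n - a) %% n < (b + n - a) %% n)%N.

(* A rectangle on the torus starting at generator x is determined by the  *)
(* column a of its lower-left corner and the column b of its upper-right  *)
(* corner (a != b): lower-left (a, x a), upper-right (b, x b) are points  *)
(* of x, upper-left (a, x b) and lower-right (b, x a) are points of       *)
(* y = rect_end x a b.  It consists of the squares (c, r) with c in        *)
(* [a, b) and r in [x a, x b) cyclically.                                  *)
Definition rect (n : nat) := (gen n * 'I_n * 'I_n)%type.
Definition rect_ok n (r : rect n) : bool := r.1.2 != r.2.
Definition rect_start n (r : rect n) : gen n := r.1.1.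
Definition rect_end n (r : rect n) : gen n := (tperm r.1.2 r.2 * r.1.1)%g.

Definition rect_dom n (r : rect n) (c row : 'I_n) : nat :=
  let: (x, a, b) := r in (cyc_in a b c && cyc_in (x a) (x b) row : nat).

Definition rect_empty n (r : rect n) : bool :=
  let: (x, a, b) := r in
  [forall c : 'I_n, ~~ (cyc_open a b c && cyc_open (x a) (x b) (x c))].

Definition rect_noX n (sX : {perm 'I_n}) (r : rect n) : bool :=
  [forall c : 'I_n, rect_dom r c (sX c) == 0%N].

Definition Omult n (sO : {perm 'I_n}) (r : rect n) (i : 'I_n) : nat :=
  rect_dom r i (sO i).

(* Sign assignments (Manolescu-Ozsvath-Szabo-Thurston): a function S on   *)
(* all rectangles with values +-1 such that                               *)
(*  (Sq) for four distinct rectangles with r1 * r2 = r1' * r2' (same      *)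
(*       initial and final generators, equal domains),                     *)
(*       S r1 S r2 = - S r1' S r2';                                         *)
(*  (V)  if r1 * r2 is a vertical annulus, S r1 S r2 = -1;                  *)
(*  (H)  if r1 * r2 is a horizontal annulus, S r1 S r2 = 1.                 *)

Definition composable n (r1 r2 : rect n) : Prop :=
  [/\ rect_ok r1, rect_ok r2 & rect_start r2 = rect_end r1].

Definition vertical_annulus n (D : 'I_n -> 'I_n -> nat) : Prop :=
  exists a b : 'I_n, a != b /\
    forall c row, D c row = (cyc_in a b c : nat).

Definition horizontal_annulus n (D : 'I_n -> 'I_n -> nat) : Prop :=
  exists a b : 'I_n, a != b /\
    forall c row, D c row = (cyc_in a b row : nat).

Definition comp_dom n (r1 r2 : rect n) (c row : 'I_n) : nat :=
  (rect_dom r1 c row + rect_dom r2 c row)%N.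

Definition sign_assignment n (S : rect n -> int) : Prop :=
  [/\ forall r : rect n, rect_ok r -> S r = 1 \/ S r = -1,
      (forall r1 r2 r1' r2' : rect n,
         composable r1 r2 -> composable r1' r2' ->
         rect_start r1 = rect_start r1' -> rect_end r2 = rect_end r2' ->
         (forall c row, comp_dom r1 r2 c row = comp_dom r1' r2' c row) ->
         (r1 != r2) && (r1 != r1') && (r1 != r2') && (r2 != r1') && (r2 != r2') && (r1' != r2') ->
         S r1 * S r2 = - (S r1' * S r2')),
      (forall r1 r2 : rect n, composable r1 r2 ->
         rect_end r2 = rect_start r1 ->
         vertical_annulus (comp_dom r1 r2) -> S r1 * S r2 = -1) &
      (forall r1 r2 : rect n, composable r1 r2 ->
         rect_end r2 = rect_start r1 ->
         horizontal_annulus (comp_dom r1 r2) -> S r1 * S r2 = 1)].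

(* The complex CL^-(G): free Z[U_1..U_n]-module on S(G), elements are      *)
(* finite functions S(G) -> Z[U].                                          *)

Definition ring_U (n : nat) := {mpoly int[n]}.
Definition CL (n : nat) := {ffun gen n -> ring_U n}.

Definition rect_weight n (sO : {perm 'I_n}) (r : rect n) : ring_U n :=
  \prod_(i < n) 'X_i ^+ Omult sO r i.

Definition counted n (sX : {perm 'I_n}) (r : rect n) : bool :=
  [&& rect_ok r, rect_empty r & rect_noX sX r].

Definition dCL n (sX sO : {perm 'I_n}) (S : rect n -> int) (f : CL n) : CL n :=
  [ffun y : gen n =>
     \sum_(r : rect n | counted sX r && (rect_end r == y))
        f (rect_start r) * ((S r)%:~R * rect_weight sO r)].

Definition genmul n (p : ring_U n) (x : gen n) : CL n :=
  [ffun y => if y == x then p else 0].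

(* x^-: lower-left corners of the X squares: point (c, sX c) on vertical *)
(* circle c.                                                               *)
Definition xminus n (sX : {perm 'I_n}) : gen n := sX.

(* x^+: upper-right corners of the X squares: the corner of square        *)
(* (c, sX c) is (c+1, sX c + 1), so x^+ (j) = sX (j - 1) + 1 (mod n).      *)
Definition xplus_fun n (sX : {perm 'I_n}) (j : 'I_n) : 'I_n :=
  ordS (sX (ord_pred j)).
Lemma xplus_fun_inj n (sX : {perm 'I_n}) : injective (xplus_fun sX).
Proof.
move=> i j /ordS_inj /perm_inj; exact: ord_pred_inj.
Qed.
Definition xplus n (sX : {perm 'I_n}) : gen n := perm (@xplus_fun_inj n sX).

(* the homology class of z in H_*(CL^-) : U_i^d [z] = 0 iff U_i^d z is a  *)
(* boundary                                                                *)
Definition is_boundary n (sX sO : {perm 'I_n}) (S : rect n -> int) (z : CL n) :=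
  exists c : CL n, dCL sX sO S c = z.

(* Main.v *)
(** Reduce modulo 2 and set all [U_i = 1]; the O's disappear and it suffices to
    find a cocycle, for the complex over F_2 counting empty X-free rectangles,
    that takes the value 1 on [x^-].  For each [i], counting the empty rectangles
    whose only X is [X_i] (with multiplicity one) commutes with the differential:
    weighting [X_i] by a variable in the proof that the differential squares to
    zero, the only unpaired domains are the thin row and the thin column through
    [X_i], which cancel.  No X-free rectangle ends at the state of upper left
    corners, so the indicator of that state is a cocycle; apply to it the
    operators of [X_1], .., [X_{n-1}].  The value on [x^-] is the number of
    chains of [n-1] rectangles from [x^-] to the upper left corners that pass
    over [X_{n-1}], .., [X_1] in this order and avoid [X_0].  The total domain of
    such a chain is forced (the squares weakly right of these X's), and this
    leaves exactly one chain.  The statement for [x^+] follows by rotating the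
    torus by 180 degrees. *)

Require Import Defs.
From mathcomp Require Import all_boot all_order all_algebra all_fingroup.
From mathcomp Require Import mpoly.
From mathcomp Require Import zify ring.
Set Implicit Arguments. Unset Strict Implicit. Unset Printing Implicit Defensive.
Import GRing.Theory.
Local Open Scope ring_scope.

(** * Cyclic intervals *)

Lemma modn_shift n (a k : 'I_n) :
  ((k + n - a) %% n = if a <= k then k - a else k + n - a)%N.
Proof.
have := ltn_ord a; have := ltn_ord k; move=> hk ha.
case: leqP => h; last by rewrite modn_small //; lia.
by rewrite -addnBAC // modnDr modn_small //; lia.
Qed.

Lemma cyc_inE n (a b k : 'I_n) :
  cyc_in a b k = (if a <= b then a <= k < b else (a <= k) || (k < b))%N.
Proof.
have := ltn_ord a; have := ltn_ord b; have := ltn_ord k; move=> hk hb ha.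
by rewrite /cyc_in !modn_shift; case: (leqP a k); case: (leqP a b) => ? ?; lia.
Qed.

Lemma cyc_openE n (a b k : 'I_n) :
  cyc_open a b k = (if a <= b then a < k < b else (a < k) || (k < b))%N.
Proof.
have := ltn_ord a; have := ltn_ord b; have := ltn_ord k; move=> hk hb ha.
by rewrite /cyc_open !modn_shift; case: (leqP a k); case: (leqP a b) => ? ?; lia.
Qed.

Lemma cyc_open_in n (a b k : 'I_n) : k != a -> cyc_open a b k = cyc_in a b k.
Proof.
by rewrite -val_eqE cyc_openE cyc_inE /= => /eqP ka; case: (leqP a b) => ?; lia.
Qed.

Lemma cyc_open_l n (a b : 'I_n) : cyc_open a b a = false.
Proof. by rewrite cyc_openE; case: (leqP a b) => ?; lia. Qed.

Lemma cyc_open_r n (a b : 'I_n) : cyc_open a b b = false.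
Proof. by rewrite cyc_openE; case: (leqP a b) => ?; lia. Qed.

Lemma cyc_in_left n (a b : 'I_n) : a != b -> cyc_in a b a.
Proof. by rewrite -val_eqE /= cyc_inE => /eqP ?; case: (leqP a b) => ?; lia. Qed.

Lemma cyc_inC n (a b k : 'I_n) : a != b -> cyc_in b a k = ~~ cyc_in a b k.
Proof.
by rewrite -val_eqE /= !cyc_inE => /eqP ab;
  case: (leqP a b); case: (leqP b a) => ? ?; lia.
Qed.

Lemma cyc_in_split n (a b c k : 'I_n) : cyc_open a c b ->
  (cyc_in a c k = cyc_in a b k || cyc_in b c k) *
  (cyc_in a b k && cyc_in b c k = false).
Proof.
rewrite cyc_openE => h; split; rewrite !cyc_inE; move: h;
  case: (leqP a b); case: (leqP b c); case: (leqP a c) => ? ? ?; lia.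
Qed.

Lemma cyc_open_rot n (a b c : 'I_n) : cyc_open a c b = cyc_open b a c.
Proof. by rewrite !cyc_openE; case: (leqP a c); case: (leqP b a) => ? ?; lia. Qed.

Lemma cyc_open_total n (a b c : 'I_n) : a != b -> b != c -> a != c ->
  cyc_open b c a = ~~ cyc_open a c b.
Proof.
rewrite -!val_eqE /= => /eqP ? /eqP ? /eqP ?.
by rewrite !cyc_openE; case: (leqP a c); case: (leqP b c) => ? ?; lia.
Qed.

Lemma cyc_open_neq n (a b c : 'I_n) : cyc_open a c b ->
  [/\ a != b, b != c & a != c].
Proof.
by rewrite cyc_openE -!val_eqE /=; case: (leqP a c) => ? h; split; apply/eqP; lia.
Qed.

Lemma cyc_orient n (a b c : 'I_n) : cyc_open a c b ->
  ((cyc_open a c b = true) * (cyc_open b a c = true) * (cyc_open c b a = true)) *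
  ((cyc_open a b c = false) * (cyc_open b c a = false) * (cyc_open c a b = false)).
Proof.
rewrite !cyc_openE; case: (leqP a c); case: (leqP b a); case: (leqP c b);
  case: (leqP a b); case: (leqP b c); case: (leqP c a) => ? ? ? ? ? ? ?;
  do ?split; lia.
Qed.

Lemma ordS_val n (a : 'I_n) : ordS a = (if a.+1 == n then 0 else a.+1)%N :> nat.
Proof.
rewrite /=; case: eqP => [->|h]; first exact: modnn.
by rewrite modn_small //; have := ltn_ord a; lia.
Qed.

Lemma ordS_neq n (a : 'I_n) : (1 < n)%N -> a != ordS a.
Proof. by move=> n1; apply/eqP => h; have := ordS_val a; rewrite -h; case: eqP; lia. Qed.

Lemma cyc_in_ordS n (a k : 'I_n) : (1 < n)%N -> cyc_in a (ordS a) k = (k == a).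
Proof.
move=> n1; rewrite cyc_inE ordS_val -val_eqE /=.
have := ltn_ord a; have := ltn_ord k.
by case: (eqVneq a.+1 n) => h ? ?; [case: (leqP a 0) | case: (leqP a a.+1)]; lia.
Qed.

(** Every grid circle carries a point of the generator, so an annulus is empty only if no circle
    lies strictly between its two sides. This singles out the thin annuli. *)
Lemma cyc_in_width1 n (a b : 'I_n) : (1 < n)%N -> a != b ->
  [forall k, ~~ ((k \notin [:: a; b]) && cyc_in a b k)] = (b == ordS a).
Proof.
move=> n1 ab; apply/forallP/eqP => [H | -> k]; last first.
  by rewrite cyc_in_ordS // !inE; case: (k == a); rewrite ?andbF.
apply/eqP; have := H (ordS a); apply: contraR => hb.
rewrite !inE negb_or eq_sym ordS_neq //= eq_sym hb /=.
move: ab hb; rewrite cyc_inE -!(inj_eq val_inj) [val (ordS a)]ordS_val ordS_val /=.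
have := ltn_ord a; have := ltn_ord b.
by case: (eqVneq a.+1 n) => ?; case: (leqP a b) => ? ? ? /eqP ? /eqP ?; lia.
Qed.

(* This is why two rectangles with disjoint corner columns can be performed in
   either order. *)
Lemma crossing_rectangles n (a b c d s t u v : 'I_n) :
  uniq [:: a; b; c; d] -> uniq [:: s; t; u; v] ->
  [&& ~~ (cyc_open a b c && cyc_open s t u),
      ~~ (cyc_open a b d && cyc_open s t v),
      ~~ (cyc_open c d a && cyc_open u v t) &
      ~~ (cyc_open c d b && cyc_open u v s)] =
  [&& ~~ (cyc_open c d a && cyc_open u v s),
      ~~ (cyc_open c d b && cyc_open u v t),
      ~~ (cyc_open a b c && cyc_open s t v) &
      ~~ (cyc_open a b d && cyc_open s t u)].
Proof.
(* Of two pairs of points on a circle, either each separates the other, which fixes both values, or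
   neither does, and one bit is left. The claim then becomes a truth table. *)
have key (i j k l : 'I_n) : uniq [:: i; j; k; l] ->
   (cyc_open k l i, cyc_open k l j) =
   (if cyc_open i j k then
      if cyc_open i j l then
        if cyc_open k l i then (true, true) else (false, false)
      else (false, true)
    else if cyc_open i j l then (true, false)
      else if cyc_open k l i then (true, true) else (false, false)).
  rewrite /= !inE !negb_or -!val_eqE /= => h.
  have {h} h : [/\ i <> j :> nat, i <> k :> nat, i <> l :> nat &
               [/\ j <> k :> nat, j <> l :> nat & k <> l :> nat]].
    by split; [lia | lia | lia | split; lia].
  case: h => ? ? ? [? ? ?].
  rewrite !cyc_openE.
  case: (leqP i j) => ?; case: (leqP k l) => ?;
    repeat case: ifP => ?; congr pair; lia.
move=> /key + /key.
case: (cyc_open a b c); case: (cyc_open a b d); case: (cyc_open s t u);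
  case: (cyc_open s t v); case: (cyc_open c d a); case: (cyc_open c d b);
  by case: (cyc_open u v s); case: (cyc_open u v t).
Qed.

(** * Pairs of rectangles *)

Lemma tperm_rot (T : finType) (a b c : T) : a != c -> b != c ->
  (tperm a c * tperm a b = tperm a b * tperm b c)%g.
Proof. by move=> ac bc; rewrite [LHS]conjgC tpermJ tpermL tpermD. Qed.

Section Weights.

Variables (n : nat) (R : comNzRingType) (sX : {perm 'I_n}) (v : 'I_n -> R).
Implicit Types (x y : gen n) (a b c k : 'I_n) (E : seq 'I_n) (A : pred 'I_n).

(** Giving an X the weight 0 forbids it; giving it a variable records its multiplicity. *)
Definition Xweight A A' : R := \prod_c (if A c && A' (sX c) then v c else 1).

Definition wt x a b : R :=
  ((a != b) && rect_empty (x, a, b))%:R * Xweight (cyc_in a b) (cyc_in (x a) (x b)).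

(* The contribution of the region [A * A'], where only the points of the
   generator outside the columns [E] are obstructions. *)
Definition region E x A A' : R :=
  [forall c, ~~ [&& c \notin E, A c & A' (x c)]]%:R * Xweight A A'.

Lemma XweightUl A1 A2 A A' : (forall k, (A k = A1 k || A2 k) * (A1 k && A2 k = false)) ->
  Xweight A A' = Xweight A1 A' * Xweight A2 A'.
Proof.
move=> h; rewrite -big_split; apply: eq_bigr => c _; have [-> hc] := h c.
by move: hc; case: (A1 c); case: (A2 c); case: (A' (sX c)) => //=;
   rewrite ?mulr1 ?mul1r.
Qed.

Lemma XweightUr A1 A2 A A' : (forall k, (A k = A1 k || A2 k) * (A1 k && A2 k = false)) ->
  Xweight A' A = Xweight A' A1 * Xweight A' A2.
Proof.
move=> h; rewrite -big_split; apply: eq_bigr => c _; have [-> hc] := h (sX c).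
by move: hc; case: (A1 _); case: (A2 _); case: (A' c) => //=;
   rewrite ?mulr1 ?mul1r.
Qed.

Lemma forall_and_natr (P Q S : pred 'I_n) : (forall c, P c = Q c && S c) ->
  [forall c, P c]%:R = [forall c, Q c]%:R * [forall c, S c]%:R :> R.
Proof.
move=> h; rewrite -natrM mulnb; congr ((nat_of_bool _)%:R).
apply/forallP/andP => [H | [/forallP H1 /forallP H2] c]; last by rewrite h H1 H2.
by split; apply/forallP => c; have := H c; rewrite h => /andP[].
Qed.

(** Fixing [E] is what allows cutting: the pieces ignore the same columns although their own corners
    differ, so obstructions and weights both split over a disjoint union. *)
Lemma regionUl E x A1 A2 A A' :
  (forall k, (A k = A1 k || A2 k) * (A1 k && A2 k = false)) ->
  region E x A A' = region E x A1 A' * region E x A2 A'.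
Proof.
move=> h; rewrite /region (XweightUl _ h) mulrACA; congr (_ * _).
apply: forall_and_natr => c; rewrite (h c).1.
by case: (c \notin E); case: (A1 c); case: (A2 c); case: (A' _).
Qed.

Lemma regionUr E x A1 A2 A A' :
  (forall k, (A k = A1 k || A2 k) * (A1 k && A2 k = false)) ->
  region E x A' A = region E x A' A1 * region E x A' A2.
Proof.
move=> h; rewrite /region (XweightUr _ h) mulrACA; congr (_ * _).
apply: forall_and_natr => c; rewrite (h (x c)).1.
by case: (c \notin E); case: (A1 _); case: (A2 _); case: (A' _).
Qed.

Lemma region_tperm E x a b A A' : a \in E -> b \in E ->
  region E (tperm a b * x)%g A A' = region E x A A'.
Proof.
move=> aE bE; rewrite /region; congr ((nat_of_bool _)%:R * _).
apply: eq_forallb => c; case cE: (c \in E) => //=; rewrite permM tpermD //.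
  by apply: contraFneq cE => <-.
by apply: contraFneq cE => <-.
Qed.

(** Points off the corner columns lie in the open rectangle as soon as they lie in the half-open
    one, so only the columns of [E] need a separate test. *)
Lemma wtE E x a b : a != b -> a \in E -> b \in E ->
  wt x a b = (all (fun c => ~~ (cyc_open a b c && cyc_open (x a) (x b) (x c))) E)%:R *
    region E x (cyc_in a b) (cyc_in (x a) (x b)).
Proof.
move=> ab aE bE; rewrite /wt /region ab mulrA; congr (_ * _).
rewrite -natrM mulnb; congr ((nat_of_bool _)%:R).
have off c : c \notin E -> cyc_open a b c && cyc_open (x a) (x b) (x c) =
    cyc_in a b c && cyc_in (x a) (x b) (x c).
  move=> cE; have ca : c != a by apply: contraNneq cE => ->.
  by rewrite !cyc_open_in // (inj_eq perm_inj).
apply/forallP/andP => [H | [/allP H1 /forallP H2] c].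
  split; first by apply/allP => c _; apply: H.
  apply/forallP => c; case cE: (c \in E) => //=.
  by rewrite -off ?cE //; apply: H.
case cE: (c \in E); first exact: H1.
by have := H2 c; rewrite cE /= off ?cE.
Qed.

(** * Cancellation of two-step chains in characteristic 2 *)

Section Cochain.

Variable phi : gen n -> R.

Definition pair_wt x a b a' b' : R :=
  wt x a b * wt (tperm a b * x)%g a' b' * phi (tperm a' b' * (tperm a b * x))%g.

Section ThreeColumns.

Variables (x : gen n) (E : seq 'I_n).

Let reg a b c d := region E x (cyc_in a b) (cyc_in (x c) (x d)).
Let ok a b c s t u := ~~ (cyc_open a b c && cyc_open (x s) (x t) (x u)).
Let F := pair_wt x.

Lemma pair_wt3 a b c : uniq [:: a; b; c] -> E =i [:: a; b; c] ->
  [/\ F a b a c = (ok a b c a b c && ok a c b b c a)%:R * (reg a b a b * reg a c b c) *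
                  phi (tperm a c * tperm a b * x)%g,
      F a b b c = (ok a b c a b c && ok b c a a c b)%:R * (reg a b a b * reg b c a c) *
                  phi (tperm b c * tperm a b * x)%g,
      F a b c a = (ok a b c a b c && ok c a b c b a)%:R * (reg a b a b * reg c a c b) *
                  phi (tperm a c * tperm a b * x)%g &
      F a b c b = (ok a b c a b c && ok c b a c a b)%:R * (reg a b a b * reg c b c a) *
                  phi (tperm b c * tperm a b * x)%g].
Proof.
rewrite /= !inE negb_or andbT => /andP[/andP[ab ac] bc] EE.
have [ba ca cb] : [/\ b != a, c != a & c != b] by rewrite ![_ == a]eq_sym [c == b]eq_sym.
have [aE bE cE] : [/\ a \in E, b \in E & c \in E] by rewrite !EE !inE !eqxx !orbT.
have y A A' : region E (tperm a b * x)%g A A' = region E x A A' := region_tperm _ _ _ aE bE.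
have allE (P : pred 'I_n) : all P E = [&& P a, P b & P c].
  by rewrite (eq_all_r EE) /= andbT.
split; rewrite /F /pair_wt mulgA ?[tperm c _]tpermC !(wtE _ _ aE bE, wtE _ _ aE cE,
    wtE _ _ bE cE, wtE _ _ cE aE, wtE _ _ cE bE) // !allE !y
    !permM !tpermL !tpermR !(tpermD ac bc) !cyc_open_l !cyc_open_r ?andbF /= ?andbT;
  by rewrite mulrACA -natrM mulnb.
Qed.

End ThreeColumns.

Hypothesis char2 : 1 + 1 = 0 :> R.

Lemma addrr2 (z : R) : z + z = 0.
Proof. by rewrite -[z]mul1r -mulrDl char2 mul0r. Qed.

Definition triple_wt x a b c : R :=
  pair_wt x a b a c + pair_wt x a b b c + pair_wt x a b c a + pair_wt x a b c b.

(** All orders of three columns together give 24 chains. The hypothesis fixes the cyclic order of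
    the columns; the two possible cyclic orders of the rows give the two cases. *)
Lemma triple_wt_cancel x a b c : cyc_open a c b ->
  (triple_wt x a b c + triple_wt x b a c) +
  ((triple_wt x b c a + triple_wt x c b a) +
   (triple_wt x c a b + triple_wt x a c b)) = 0.
Proof.
move=> co; have [ab bc ac] := cyc_open_neq co.
have [ba cb ca] : [/\ b != a, c != b & c != a].
  by rewrite ![_ == a]eq_sym [c == b]eq_sym.
have col := cyc_orient co.
pose E := [:: a; b; c].
have U i j k : i != j -> j != k -> i != k -> uniq [:: i; j; k].
  by move=> h1 h2 h3; rewrite /= !inE negb_or h1 h2 h3.
have [e1 e2 e3 e4] := @pair_wt3 x E a b c (U _ _ _ ab bc ac) (fun=> erefl).
have [||e5 e6 e7 e8] := @pair_wt3 x E b a c; first exact: U.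
  by move=> k; rewrite !inE; do 3 case: eqP.
have [||e9 e10 e11 e12] := @pair_wt3 x E b c a; first exact: U.
  by move=> k; rewrite !inE; do 3 case: eqP.
have [||e13 e14 e15 e16] := @pair_wt3 x E c b a; first exact: U.
  by move=> k; rewrite !inE; do 3 case: eqP.
have [||e17 e18 e19 e20] := @pair_wt3 x E c a b; first exact: U.
  by move=> k; rewrite !inE; do 3 case: eqP.
have [||e21 e22 e23 e24] := @pair_wt3 x E a c b; first exact: U.
  by move=> k; rewrite !inE; do 3 case: eqP.
have s1 : (tperm a b * tperm b c = tperm a c * tperm a b)%g by rewrite tperm_rot.
have s2 : (tperm b c * tperm a c = tperm a c * tperm a b)%g.
  by rewrite [RHS]tperm_rot // [tperm a b]tpermC [RHS]tperm_rot // [tperm c a]tpermC.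
have t1 : (tperm a b * tperm a c = tperm b c * tperm a b)%g.
  by rewrite [tperm a b]tpermC tperm_rot.
have t2 : (tperm a c * tperm b c = tperm b c * tperm a b)%g.
  by rewrite -t1 [tperm b c]tpermC tperm_rot.
have sl A' := (regionUl E x A' (fun k => cyc_in_split k co),
  regionUl E x A' (fun k => cyc_in_split k (etrans (esym (cyc_open_rot _ _ _)) co)),
  regionUl E x A' (fun k => cyc_in_split k (etrans (cyc_open_rot _ _ _) co))).
have ro : cyc_open (x a) (x c) (x b) || cyc_open (x b) (x c) (x a).
  by rewrite [X in _ || X]cyc_open_total ?(inj_eq perm_inj) // orbN.
have sr i j k (h : cyc_open (x i) (x j) (x k)) A' :=
  (regionUr E x A' (fun l => cyc_in_split l h),
   regionUr E x A' (fun k => cyc_in_split k (etrans (esym (cyc_open_rot _ _ _)) h)),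
   regionUr E x A' (fun k => cyc_in_split k (etrans (cyc_open_rot _ _ _) h))).
have evalE := (e1, e2, e3, e4, (e5, e6, e7, e8), (e9, e10, e11, e12),
  (e13, e14, e15, e16), (e17, e18, e19, e20), (e21, e22, e23, e24)).
have permE := (tpermC b a, tpermC c b, tpermC c a, (s1, s2, t1, t2)).
(* The nonzero terms come in six pairs, the two ways to cut an L-shaped domain. *)
case/orP: ro => ro; have row := cyc_orient ro.
- transitivity ((1 + 1) * (pair_wt x a b a c + pair_wt x a b b c +
    pair_wt x b c b a + pair_wt x b c c a + pair_wt x c a c b + pair_wt x c a a b)).
    by rewrite /triple_wt !evalE !col !row /= !permE !sl !(sr _ _ _ ro); ring.
  by rewrite char2 mul0r.
- transitivity ((1 + 1) * (pair_wt x a b b c + pair_wt x b c c a +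
    pair_wt x c a a b + pair_wt x a b c a + pair_wt x b c a b + pair_wt x c a b c)).
    by rewrite /triple_wt !evalE !col !row /= !permE !sl !(sr _ _ _ ro); ring.
  by rewrite char2 mul0r.
Qed.

(** Neither swap moves a point outside [E], so the regions are unchanged. What remains are the
    mutual obstructions of the corners, settled by [crossing_rectangles]. *)
Lemma pair_wt_swap x a b c d : uniq [:: a; b; c; d] ->
  pair_wt x a b c d = pair_wt x c d a b.
Proof.
move=> U; have := U; rewrite /= !inE !negb_or -!andbA => /and5P[ab ac ad bc /and3P[bd cd _]].
pose E := [:: a; b; c; d].
have [aE bE cE dE] : [/\ a \in E, b \in E, c \in E & d \in E].
  by rewrite !inE !eqxx !orbT.
have [ca cb da db] : [/\ c != a, c != b, d != a & d != b].
  by rewrite ![_ == a]eq_sym ![_ == b]eq_sym.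
have perm_comm : (tperm c d * tperm a b = tperm a b * tperm c d)%g.
  by rewrite conjgC tpermJ !tpermD.
rewrite /pair_wt !mulgA perm_comm; congr (_ * _).
rewrite (wtE x ab aE bE) (wtE x cd cE dE) (wtE _ ab aE bE) (wtE _ cd cE dE).
have tE := (permM, tpermL, tpermR, (tpermD ac bc, tpermD ad bd, tpermD ca da, tpermD cb db)).
rewrite !region_tperm // !tE.
rewrite mulrACA [RHS]mulrACA [region _ _ _ _ * _]mulrC; congr (_ * _).
rewrite -!natrM !mulnb; congr ((nat_of_bool _)%:R).
rewrite /= !tE !cyc_open_l !cyc_open_r !andbF /= !andbT -!(andbA (~~ _) (~~ _)).
apply: crossing_rectangles => //.
exact: etrans (map_inj_uniq (@perm_inj _ x) [:: a; b; c; d]) U.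
Qed.

Lemma sum_symmetric (T : finType) (G : T -> T -> R) :
  (forall i j, G i j = G j i) -> (forall i, G i i = 0) ->
  \sum_i \sum_j G i j = 0.
Proof.
move=> Gs G0; pose lt (i j : T) := (enum_rank i < enum_rank j)%N.
have -> : \sum_i \sum_j G i j =
    \sum_i \sum_j (if lt i j then G i j else 0) +
    \sum_i \sum_j (if lt j i then G i j else 0).
  rewrite -big_split; apply: eq_bigr => i _; rewrite -big_split; apply: eq_bigr => j _.
  rewrite /lt /=; case: ltngtP => [||/val_inj/enum_rank_inj <-]; rewrite ?addr0 ?add0r //.
rewrite [X in _ + X]exchange_big /=.
under [X in _ + X]eq_bigr => i _ do under eq_bigr => j _ do rewrite Gs.
exact: addrr2.
Qed.

Lemma sum_off2 (f : 'I_n -> R) a b : a != b ->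
  \sum_i f i = f a + f b + \sum_(i | (i != a) && (i != b)) f i.
Proof.
by move=> ab; rewrite (bigD1 a) //= (bigD1 b) //= 1?eq_sym // addrA.
Qed.

Lemma pair_wt_diag x a b c d : c = d -> pair_wt x a b c d = 0.
Proof. by move=> ->; rewrite /pair_wt /wt eqxx /= mul0r mulr0 mul0r. Qed.

(** The second rectangle shares both columns, one column or none with the first: these are the
    annuli, the chains in [triple_wt] and the independent pairs. *)
Lemma pair_wt_split x a b : a != b ->
  \sum_c \sum_d pair_wt x a b c d =
  pair_wt x a b a b + pair_wt x a b b a +
  \sum_(c | (c != a) && (c != b)) triple_wt x a b c +
  \sum_(c | (c != a) && (c != b)) \sum_(d | (d != a) && (d != b)) pair_wt x a b c d.
Proof.
move=> ab; rewrite (sum_off2 _ ab) !(sum_off2 (pair_wt x a b _) ab).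
rewrite !(pair_wt_diag x _ _ (erefl _)).
under [X in _ + X = _]eq_bigr => c _ do rewrite (sum_off2 _ ab).
rewrite /triple_wt !big_split /=.
ring.
Qed.

(* The sum over oriented triples is replaced by three copies of itself, one for
   each rotation, as [3 = 1] in [R]. *)
Lemma sum_triple_wt x :
  \sum_a \sum_b \sum_c (if uniq [:: a; b; c] then triple_wt x a b c else 0) = 0.
Proof.
pose P a b c (z : R) := if cyc_open a c b then z else 0.
pose H a b c := P a b c (triple_wt x a b c + triple_wt x b a c).
transitivity (\sum_a \sum_b \sum_c H a b c).
  transitivity (\sum_a \sum_b \sum_c P a b c (triple_wt x a b c) +
                \sum_a \sum_b \sum_c P b a c (triple_wt x a b c)).
    rewrite -big_split; apply: eq_bigr => a _; rewrite -big_split.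
    apply: eq_bigr => b _; rewrite -big_split; apply: eq_bigr => c _.
    rewrite /P /=; case: ifP => [|U].
      rewrite /= !inE negb_or andbT => /andP[/andP[ab ac] bc].
      by rewrite (cyc_open_total ab bc ac); case: ifP => _; rewrite ?addr0 ?add0r.
    case: ifP => [/cyc_open_neq[ab bc ac]|_].
      by move: U; rewrite /= !inE negb_or ab bc ac.
    case: ifP => [/cyc_open_neq[ab bc ac]|_]; last by rewrite addr0.
    by move: U; rewrite /= !inE negb_or eq_sym ab bc ac.
  rewrite [X in _ + X]exchange_big /=.
  do 3 (rewrite -big_split; apply: eq_bigr => ? _).
  by rewrite /H /P; case: ifP => _ //=; rewrite addr0.
transitivity (\sum_a \sum_b \sum_c H a b c +
  (\sum_a \sum_b \sum_c H b c a + \sum_a \sum_b \sum_c H c a b)).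
  have -> : \sum_a \sum_b \sum_c H b c a = \sum_a \sum_b \sum_c H a b c.
    by rewrite exchange_big; apply: eq_bigr => b _; apply: exchange_big.
  have -> : \sum_a \sum_b \sum_c H c a b = \sum_a \sum_b \sum_c H a b c.
    by rewrite [RHS]exchange_big; apply: eq_bigr => b _; apply: exchange_big.
  by rewrite addrr2 addr0.
rewrite -!big_split big1 // => a _; rewrite -!big_split big1 // => b _.
rewrite -!big_split big1 // => c _; rewrite /H /P /=.
rewrite -[cyc_open c b a]cyc_open_rot -[cyc_open b a c]cyc_open_rot.
by case: ifP => co; [apply: triple_wt_cancel | rewrite !addr0].
Qed.

(** The two rectangles fill the columns from [a] to [b] completely. Emptiness forces width one, and
    then the only X inside is that of column [a]. *)
Lemma vertical_annuli x a b : (1 < n)%N -> a != b ->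
  pair_wt x a b a b = if b == ordS a then v a * phi x else 0.
Proof.
move=> n1 ab; pose E := [:: a; b].
have [aE bE] : a \in E /\ b \in E by rewrite !inE !eqxx orbT.
rewrite /pair_wt mulgA tperm2 mul1g !(wtE _ ab aE bE) !region_tperm //.
rewrite /= !permM !tpermL !tpermR !cyc_open_l !cyc_open_r !andbF /= !mul1r.
rewrite -(@regionUr E x _ _ predT); last first.
  move=> k; rewrite /= [cyc_in (x b) _ _]cyc_inC ?(inj_eq perm_inj) //.
  by rewrite orbN andbN.
rewrite /region; under eq_forallb => c do rewrite andbT.
rewrite cyc_in_width1 //; case: eqP => [->|_]; last by rewrite !mul0r.
rewrite mul1r /Xweight (bigD1 a) //= cyc_in_ordS // eqxx big1 ?mulr1 // => c ca.
by rewrite cyc_in_ordS // (negbTE ca).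
Qed.

(** The transposed case: the only X inside a thin row is that of row [x a]. *)
Lemma horizontal_annuli x a b : (1 < n)%N -> a != b ->
  pair_wt x a b b a = if x b == ordS (x a) then v ((sX^-1)%g (x a)) * phi x else 0.
Proof.
move=> n1 ab; pose E := [:: a; b].
have ba : b != a by rewrite eq_sym.
have [aE bE] : a \in E /\ b \in E by rewrite !inE !eqxx orbT.
rewrite /pair_wt mulgA [tperm b a]tpermC tperm2 mul1g.
rewrite (wtE _ ab aE bE) (wtE _ ba bE aE) !region_tperm //.
rewrite /= !permM !tpermL !tpermR !cyc_open_l !cyc_open_r !andbF /= !mul1r.
rewrite -(@regionUl E x _ _ predT); last first.
  by move=> k; rewrite /= [cyc_in b _ _]cyc_inC // orbN andbN.
rewrite /region; have -> : [forall c, ~~ [&& c \notin E, predT c & cyc_in (x a) (x b) (x c)]] =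
    [forall k, ~~ ((k \notin [:: x a; x b]) && cyc_in (x a) (x b) k)].
  apply/forallP/forallP => h k; last first.
    by have := h (x k); rewrite !inE !(inj_eq perm_inj).
  by have := h ((x^-1)%g k); rewrite -[k in X in _ -> X](permKV x) !inE !(inj_eq perm_inj).
rewrite cyc_in_width1 ?(inj_eq perm_inj) //; case: eqP => [->|_]; last by rewrite !mul0r.
rewrite mul1r /Xweight (bigD1 ((sX^-1)%g (x a))) //= permKV cyc_in_ordS // eqxx.
rewrite big1 ?mulr1 // => c ca.
rewrite cyc_in_ordS //; case: eqP => // h; case/eqP: ca; by rewrite -h permK.
Qed.

(** Thin columns and thin rows each produce every X weight once and cancel against each other.
    Chains on three columns cancel by [sum_triple_wt], independent pairs by swapping the two
    rectangles. *)
Lemma sum_pair_wt x : (1 < n)%N ->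
  \sum_a \sum_b \sum_c \sum_d pair_wt x a b c d = 0.
Proof.
move=> n1; pose D a b (z : R) := if a != b then z else 0.
transitivity (\sum_a \sum_b (D a b (pair_wt x a b a b) + D a b (pair_wt x a b b a) +
  D a b (\sum_(c | (c != a) && (c != b)) triple_wt x a b c) +
  D a b (\sum_(c | (c != a) && (c != b)) \sum_(d | (d != a) && (d != b))
          pair_wt x a b c d))).
  apply: eq_bigr => a _; apply: eq_bigr => b _; rewrite /D.
  have [<-|ab] := eqVneq a b; last exact: pair_wt_split.
  rewrite !addr0 big1 // => c _; rewrite big1 // => d _.
  by rewrite /pair_wt /wt eqxx !mul0r.
under eq_bigr => a _ do rewrite !big_split /=.
rewrite !big_split /=.
have -> : \sum_a \sum_b D a b (pair_wt x a b a b) = \sum_a v a * phi x.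
  apply: eq_bigr => a _; rewrite (bigD1 (ordS a)) //= /D ordS_neq // vertical_annuli ?ordS_neq //.
  rewrite eqxx big1 ?addr0 // => b ba; case: ifP => // ab.
  by rewrite vertical_annuli // (negbTE ba).
have -> : \sum_a \sum_b D a b (pair_wt x a b b a) = \sum_a v a * phi x.
  rewrite [RHS](reindex_inj (h := fun a => (sX^-1)%g (x a))) /=; last first.
    by move=> a b /perm_inj/perm_inj.
  apply: eq_bigr => a _; pose b0 := (x^-1)%g (ordS (x a)).
  have xb0 : x b0 = ordS (x a) by rewrite permKV.
  have ab0 : a != b0 by rewrite -(inj_eq (@perm_inj _ x)) xb0 ordS_neq.
  rewrite (bigD1 b0) //= /D ab0 horizontal_annuli // xb0 eqxx big1 ?addr0 // => b bb.
  case: ifP => // ab; rewrite horizontal_annuli // -xb0 (inj_eq perm_inj).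
  by rewrite (negbTE bb).
rewrite addrr2 add0r.
have -> : \sum_a \sum_b D a b (\sum_(c | (c != a) && (c != b)) triple_wt x a b c) = 0.
  rewrite -[RHS](sum_triple_wt x); apply: eq_bigr => a _; apply: eq_bigr => b _.
  rewrite /D; case: (boolP (a != b)) => [ab|].
    rewrite big_mkcond; apply: eq_bigr => c _.
    by rewrite /= !inE negb_or ab [c == a]eq_sym [c == b]eq_sym andbT.
  by rewrite negbK => /eqP <-; rewrite big1 // => c _; rewrite /= !inE eqxx.
rewrite add0r.
pose G (p q : 'I_n * 'I_n) :=
  if uniq [:: p.1; p.2; q.1; q.2] then pair_wt x p.1 p.2 q.1 q.2 else 0.
transitivity (\sum_p \sum_q G p q).
  rewrite pair_bigA /=; apply: eq_bigr => -[a b] _; rewrite /D /=.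
  case: (boolP (a != b)) => [ab|]; last first.
    by rewrite negbK => /eqP <-; rewrite big1 // => c _; rewrite /G /= !inE eqxx.
  rewrite -(pair_bigA _ (fun c d => G (a, b) (c, d))) /= big_mkcond.
  apply: eq_bigr => c _; rewrite big_mkcond /=.
  case: ifP => hc; last first.
    rewrite big1 // => d _; rewrite /G /=; case: ifP => //.
    rewrite /= !inE !negb_or; move: hc; rewrite ![c == _]eq_sym.
    by case: (a == c); case: (b == c); rewrite /= ?andbF.
  apply: eq_bigr => d _; rewrite /G /= !inE !negb_or ab.
  move: hc; rewrite ![c == _]eq_sym ![d == _]eq_sym => /andP[-> ->].
  have [<-|cd] := eqVneq c d; first by rewrite pair_wt_diag // !andbF !if_same.
  by rewrite !andbT.
apply: sum_symmetric => [[a b] [c d]|[a b]]; last by rewrite /G /= !inE eqxx !orbT.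
rewrite /G -(rot_uniq 2 [:: (c, d).1; _; _; _]).
by case: ifP => // U; apply: pair_wt_swap.
Qed.
End Cochain.
End Weights.

(** * Cochains modulo 2 *)

Section Cochains.

Variables (n : nat) (sX : {perm 'I_n}).
Implicit Types (x y : gen n) (r : rect n) (phi : gen n -> 'F_2).

Definition counted_at (i : 'I_n) r : bool :=
  [&& rect_ok r, rect_empty r & [forall c, rect_dom r c (sX c) == (c == i)]].

(** For [P := counted sX] this is the transpose of the differential modulo 2 with every [U_i] set to
    1. *)
Definition coboundary (P : pred (rect n)) phi x : 'F_2 :=
  \sum_a \sum_b (if P (x, a, b) then phi (rect_end (x, a, b)) else 0).

Lemma F2_addrr (z : 'F_2) : z + z = 0.
Proof. by apply/eqP; case: z => -[|[|m]]. Qed.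

Lemma F2_addr_eq0 (z w : 'F_2) : z + w = 0 -> z = w.
Proof. by move=> zw; rewrite -[z]addr0 -(F2_addrr w) addrA zw add0r. Qed.

(** All X's but that of column [i] have weight 0, and a rectangle covers a square at most once, so
    no higher power of ['X] appears. *)
Lemma wt_mark (i : 'I_n) x a b :
  wt sX (fun c => if c == i then 'X else 0 : {poly 'F_2}) x a b =
  (counted sX (x, a, b))%:R%:P + (counted_at i (x, a, b))%:R%:P * 'X.
Proof.
rewrite /wt /counted /counted_at /rect_ok /rect_noX /=.
set e := [forall c, _] : bool.
case: (a != b); last by rewrite /= !polyC0 !mul0r addr0.
case: e; last by rewrite /= !polyC0 !mul0r addr0.
rewrite mul1r /= /Xweight.
pose D c := cyc_in a b c && cyc_in (x a) (x b) (sX c).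
case: (boolP [forall c, (c != i) ==> ~~ D c]) => [/forallP H|]; last first.
  rewrite negb_forall => /existsP[c]; rewrite negb_imply negbK => /andP[ci Dc].
  rewrite (bigD1 c) //= -/(D c) Dc (negbTE ci) mul0r.
  case: forallP => [/(_ c)|_]; first by rewrite -/(D c) Dc.
  case: forallP => [/(_ c)|_]; first by rewrite -/(D c) Dc (negbTE ci).
  by rewrite polyC0 mul0r addr0.
rewrite (bigD1 i) //= big1 ?mulr1 => [|c ci]; last first.
  by have := H c; rewrite ci /= -/(D c) => /negbTE ->.
rewrite -/(D i) eqxx; case: (boolP (D i)) => Di.
  case: forallP => [/(_ i)|_]; first by rewrite -/(D i) Di.
  case: forallP => [_|[]]; first by rewrite polyC0 add0r mul1r.
  move=> c; rewrite -/(D c); have [->|ci] := eqVneq c i; first by rewrite Di.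
  by have := H c; rewrite ci /= => /negbTE ->.
case: forallP => [_|[]]; last first.
  move=> c; rewrite -/(D c); have [->|ci] := eqVneq c i; first by rewrite (negbTE Di).
  by have := H c; rewrite ci /= => /negbTE ->.
case: forallP => [/(_ i)|_]; first by rewrite -/(D i) (negbTE Di) eqxx.
by rewrite polyC0 mul0r addr0.
Qed.

Lemma coboundary_comm (i : 'I_n) phi x : (1 < n)%N ->
  coboundary (counted sX) (coboundary (counted_at i) phi) x =
  coboundary (counted_at i) (coboundary (counted sX) phi) x.
Proof.
move=> n1; apply: F2_addr_eq0.
pose v c : {poly 'F_2} := if c == i then 'X else 0.
have char2 : 1 + 1 = 0 :> {poly 'F_2}.
  by rewrite -polyC1 -polyCD F2_addrr.
have := sum_pair_wt sX v (fun y => (phi y)%:P) char2 x n1.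
(* The degree-one coefficient records the chains in which exactly one of the two rectangles covers
   the X of column [i]. *)
move=> /(congr1 (fun p : {poly 'F_2} => p`_1)); rewrite coef0 => <-.
rewrite /coboundary -big_split coef_sum; apply: eq_bigr => a _.
rewrite -big_split coef_sum; apply: eq_bigr => b _; rewrite /=.
transitivity (\sum_c \sum_d
  ((if counted sX (x, a, b) && counted_at i (rect_end (x, a, b), c, d)
    then phi (rect_end (rect_end (x, a, b), c, d)) else 0) +
   (if counted_at i (x, a, b) && counted sX (rect_end (x, a, b), c, d)
    then phi (rect_end (rect_end (x, a, b), c, d)) else 0))).
  under [RHS]eq_bigr => c _ do rewrite big_split /=.
  rewrite big_split /=; congr (_ + _).
    case: ifP => // _; rewrite big1 // => c _; rewrite big1 //.
  case: ifP => // _; rewrite big1 // => c _; rewrite big1 //.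
rewrite coef_sum; apply: eq_bigr => c _; rewrite coef_sum; apply: eq_bigr => d _.
rewrite /pair_wt !wt_mark coefMC /rect_end /=.
set P1 := counted _ _; set P2 := counted_at _ _; set Q1 := counted _ _; set Q2 := counted_at _ _.
rewrite mulrDl !mulrDr !mulrA !coefD -!mulrA.
rewrite !coefCM !coefXM !coefMX !coefC ?coefX /= !mulr0 add0r addr0.
by case: P1; case: P2; case: Q1; case: Q2;
  rewrite /= ?(mulr0, mul0r, addr0, add0r, mul1r, mulrDl).
Qed.

End Cochains.

(** * The value of the cocycle on [x^-] *)

Lemma cyc_in_last n (s t : 'I_n) : s != ordS t -> cyc_in s (ordS t) t.
Proof.
have := ltn_ord s; have := ltn_ord t => ht hs.
rewrite cyc_inE -(inj_eq val_inj) [val (ordS t)]ordS_val ordS_val /= => /eqP.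
by case: (eqVneq t.+1 n) => ?; [case: (leqP s 0)|case: (leqP s t.+1)]; lia.
Qed.

(** Between 0 and [c], the indicator of a cyclic interval rises at [a] and drops at [b]; the drop
    stands on the left to avoid subtraction. *)
Lemma interval_jump (a b c : nat) : a != b ->
  (((if a <= b then a <= c < b else (a <= c) || (c < b)) + (0 < b <= c))%N =
   ((if a <= b then a <= 0 < b else (a <= 0) || (0 < b)) + (0 < a <= c))%N :> nat)%N.
Proof. by move=> /eqP ?; case: (leqP a b) => ?; lia. Qed.

Section Heights.

Variables (n : nat) (r0 : 'I_n).
Implicit Types r s t : 'I_n.

(* Heights above the circle [r0], which is itself at height [0] as the bottom
   of a rectangle and at height [n] as the top of one. *)
Definition height r : nat := ((r + n - r0) %% n)%N.
Definition top_height r : nat := if r == r0 then n else height r.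

Lemma height_lt r : (height r < n)%N.
Proof. by rewrite ltn_mod; case: n r => [[]|]. Qed.

Lemma height0 : height r0 = 0%N.
Proof. by rewrite /height modn_shift leqnn subnn. Qed.

Lemma height_inj : injective height.
Proof.
move=> s t; rewrite /height !modn_shift => h; apply: val_inj => /=; move: h.
have := ltn_ord s; have := ltn_ord t; have := ltn_ord r0.
by case: (leqP r0 s); case: (leqP r0 t); lia.
Qed.

Lemma height_eq0 r : (height r == 0%N) = (r == r0).
Proof. by rewrite -[X in _ == X]height0 (inj_eq height_inj). Qed.

Lemma top_heightP r : (r = r0 /\ top_height r = n) \/
  (top_height r = height r /\ (0 < height r)%N).
Proof.
rewrite /top_height; have [->|h] := eqVneq r r0; first by left.
by right; rewrite lt0n height_eq0.
Qed.

Lemma top_height_inj : injective top_height.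
Proof.
move=> s t; have := height_lt s; have := height_lt t.
have [[-> ->]|[-> ?]] := top_heightP s; have [[-> ->]|[-> ?]] := top_heightP t => //.
- by move=> + _ h; rewrite -h ltnn.
- by move=> _ + h; rewrite h ltnn.
- by move=> _ _; apply: height_inj.
Qed.

Lemma height_ordS r : height (ordS r) = (if (height r).+1 == n then 0 else (height r).+1)%N.
Proof.
rewrite /height !modn_shift ordS_val.
have := ltn_ord r; have := ltn_ord r0 => ? ?.
case: (eqVneq r.+1 n) => ?.
  by case: (leqP r0 0); case: (leqP r0 r) => ? ?; case: eqVneq => ?; lia.
by case: (leqP r0 r.+1); case: (leqP r0 r) => ? ?; case: eqVneq => ?; lia.
Qed.

Lemma cyc_in_height s t r : cyc_in s t r =
  (if height s <= height t then height s <= height r < height t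
   else (height s <= height r) || (height r < height t))%N.
Proof.
rewrite cyc_inE /height !modn_shift.
have := ltn_ord r; have := ltn_ord r0; have := ltn_ord s; have := ltn_ord t => ? ? ? ?.
case: (leqP s t) => ?; case: (leqP r0 s); case: (leqP r0 t); case: (leqP r0 r) => ? ? ?;
  by case: ifP => ?; lia.
Qed.

Lemma cyc_in_top s t r : s != t -> (height s < top_height t)%N ->
  cyc_in s t r = (height s <= height r < top_height t)%N.
Proof.
rewrite -(inj_eq height_inj) cyc_in_height => /eqP.
have := height_lt s; have := height_lt r.
have [[-> ->]|[-> ?]] := top_heightP t; rewrite ?height0;
  by case: ifP => ?; lia.
Qed.

Lemma cyc_in_base s t : s != t -> ~~ cyc_in s t r0 -> (height s < top_height t)%N.
Proof.
rewrite -(inj_eq height_inj) cyc_in_height height0 => /eqP.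
have := height_lt s.
have [[-> ->]|[-> ?]] := top_heightP t; rewrite ?height0;
  by case: ifP => ?; lia.
Qed.

End Heights.

(** * Domains of chains and uniqueness of the chain *)

Section Links.

Variables (n : nat) (sX : {perm 'I_n.+1}).
Implicit Types (x y z : gen n.+1) (a b c j k r : 'I_n.+1) (M : 'I_n.+1 -> 'I_n.+1 -> nat).

Let r0 := sX ord0.

Definition corner_count y c r : nat :=
  \sum_(j < n.+1) ((0 < j <= c) && (0 < height r0 (y j) <= height r0 r))%N.

(* [M] has the multiplicities of a domain from [y] to [z], up to adding
   multiples of full rows and columns. *)
Definition link y z M : Prop := forall c r,
  (M c r + M ord0 r0 + corner_count z c r =
   M ord0 r + M c r0 + corner_count y c r)%N.

Lemma link_trans x y z M1 M2 : link x y M1 -> link y z M2 ->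
  link x z (fun c r => M1 c r + M2 c r)%N.
Proof. by move=> h1 h2 c r; have := h1 c r; have := h2 c r; lia. Qed.

(** The indicator of a rectangle is a product. By [interval_jump] in both directions its mixed
    difference is the alternating sum over the four corners, which is the change of
    [corner_count]. *)
Lemma link_rect x a b : a != b -> link x (rect_end (x, a, b)) (rect_dom (x, a, b)).
Proof.
move=> ab c r; rewrite /rect_dom /corner_count /rect_end /=.
have ba : b != a by rewrite eq_sym.
rewrite (bigD1 a) //= (bigD1 b) //= [in RHS](bigD1 a) //= [in RHS](bigD1 b) //=.
have -> : (\sum_(j < n.+1 | (j != a) && (j != b))
    ((0 < j <= c) && (0 < height r0 ((tperm a b * x)%g j) <= height r0 r)) =
  \sum_(j < n.+1 | (j != a) && (j != b))
    ((0 < j <= c) && (0 < height r0 (x j) <= height r0 r)))%N.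
  by apply: eq_bigr => j /andP[ja jb]; rewrite permM tpermD // eq_sym.
rewrite !permM tpermL tpermR.
move: (\sum_(i < _ | _) _)%N => s.
have xab : x a != x b by rewrite (inj_eq perm_inj).
have hc : (cyc_in a b c + (0 < b <= c) = cyc_in a b ord0 + (0 < a <= c) :> nat)%N.
  by rewrite !cyc_inE interval_jump.
have hr : (cyc_in (x a) (x b) r + (0 < height r0 (x b) <= height r0 r) =
           cyc_in (x a) (x b) r0 + (0 < height r0 (x a) <= height r0 r) :> nat)%N.
  by rewrite !(cyc_in_height r0) height0 interval_jump // (inj_eq (@height_inj _ r0)).
move: hc hr; case: (cyc_in a b c); case: (cyc_in a b ord0); case: (0 < a <= c)%N;
  case: (0 < b <= c)%N => //= _; case: (cyc_in _ _ r); case: (cyc_in _ _ r0) => /=; lia.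
Qed.

Definition upper_left : gen n.+1 := (sX * perm (@ordS_inj n.+1))%g.

Lemma upper_leftE j : upper_left j = ordS (sX j).
Proof. by rewrite permM permE. Qed.

(** From [sX] to [upper_left] each point rises by one row, the top row wrapping to height 0. Across
    the level of the X in column [j] only the point of column [j] is lost. *)
Lemma corner_count_upper_left j c :
  corner_count sX c (sX j) = (corner_count upper_left c (sX j) + (0 < j <= c))%N.
Proof.
rewrite /corner_count; have -> : ((0 < j <= c) : nat) =
    (\sum_(i < n.+1) (if i == j then (0 < i <= c)%N : nat else 0))%N.
  by rewrite -big_mkcond big_pred1_eq.
rewrite -big_split; apply: eq_bigr => i _ /=.
rewrite upper_leftE height_ordS -(inj_eq (@perm_inj _ sX)) -(inj_eq (@height_inj _ r0)).
have : (height r0 (sX i) == 0%N) = (i == ord0).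
  by rewrite height_eq0 (inj_eq perm_inj).
rewrite -(inj_eq val_inj) /=; have := height_lt r0 (sX j).
case: (height r0 (sX i)) => [|h]; case: (i : nat) => [|i'] //=; rewrite ?if_same //.
move=> ? _; case: (i' < c)%N; last by rewrite if_same.
by rewrite eqSS; case: eqP => ?; case: eqP => ?; lia.
Qed.

(* The domain of a chain from [x^-] to the upper left corners passing once over
   every X but the one in column 0 is determined: it is the union of the
   half-rows to the right of these X's, up to the line of column 0. *)
Lemma link_domain M : link sX upper_left M -> (forall j, M j (sX j) = (0 < j)%N) ->
  forall c j, M c (sX j) = (0 < j <= c)%N.
Proof.
move=> l m.
have m0 : M ord0 r0 = 0%N by rewrite m.
have E c j : (M c (sX j) = M ord0 (sX j) + M c r0 + (0 < j <= c))%N.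
  by have := l c (sX j); rewrite m0 corner_count_upper_left; lia.
(* At the X itself the prescribed multiplicity already equals the last summand of [E], so both
   border terms vanish. *)
have Z j : (M ord0 (sX j) = 0 /\ M j r0 = 0)%N.
  have := E j j; rewrite m leqnn andbT; case: (posnP j) => [j0 _|]; last by lia.
  by have -> : j = ord0 by apply: val_inj.
by move=> c j; rewrite E (Z j).1 (Z c).2.
Qed.

(** Unfolded, [cocycle c y] counts modulo 2 the chains from [y] to [upper_left] covering the X's of
    columns [c], ..., [1] in this order: the operator applied last sees the first rectangle. *)
Fixpoint cocycle (c : nat) : gen n.+1 -> 'F_2 :=
  if c is c'.+1 then coboundary (counted_at sX (inord c)) (cocycle c')
  else fun y => (y == upper_left)%:R.

Lemma coboundary0 (P : pred (rect n.+1)) phi x : phi =1 (fun=> 0) -> coboundary P phi x = 0.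
Proof.
by move=> h; rewrite /coboundary big1 // => a _; rewrite big1 // => b _; rewrite h if_same.
Qed.

Lemma cocycleP (c : nat) x : (0 < n)%N -> coboundary (counted sX) (cocycle c) x = 0.
Proof.
move=> n0; elim: c x => [|c IH] x /=; last first.
  by rewrite coboundary_comm // coboundary0.
rewrite /coboundary big1 // => a _; rewrite big1 // => b _.
case: ifP => // /and3P[ab _ /forallP/(_ a)].
have [e|_] := eqVneq (rect_end (x, a, b)) upper_left; last by [].
rewrite /rect_ok /= in ab.
(* The upper left corner of the rectangle is that of the X square of column [a], so this X lies
   inside. *)
have xb : x b = ordS (sX a) by rewrite -upper_leftE -e permM tpermL.
rewrite /rect_dom xb cyc_in_last ?andbT; last by rewrite -xb (inj_eq perm_inj).
by rewrite cyc_in_left.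
Qed.

Lemma cocycle_link (c : nat) y : (c <= n)%N -> cocycle c y != 0 ->
  exists2 M, link y upper_left M & forall j, M j (sX j) = (0 < j <= c)%N.
Proof.
elim: c y => [|c IH] y /= cn.
  have [-> _|_] := eqVneq y upper_left; last by rewrite eqxx.
  by exists (fun _ _ => 0%N) => // j; case: (j : nat).
move=> nz; have /existsP[[a b] /=]: [exists p : 'I_n.+1 * 'I_n.+1,
   counted_at sX (inord c.+1) (y, p.1, p.2) && (cocycle c (rect_end (y, p.1, p.2)) != 0)].
  apply: contraNT nz; rewrite negb_exists => /forallP H.
  rewrite /coboundary big1 // => a _; rewrite big1 // => b _; have := H (a, b) => /=.
  by case: ifP => //= _; rewrite negbK => /eqP.
case/andP=> /and3P[ab _ /forallP X] /(IH _ (ltnW cn))[M l m].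
exists (fun c r => rect_dom (y, a, b) c r + M c r)%N; first exact: link_trans (link_rect _ _) l.
move=> j; rewrite (eqP (X j)) m -(inj_eq val_inj) /= inordK //.
by case: eqP; lia.
Qed.

(* The states met on the unique chain from [x^-] to the upper left corners that
   treats the columns [n, n-1, .., 1] in this order: the columns of [active c]
   are done, and the points on them are at the next higher row of an X of these
   columns. *)
Definition active (c : nat) j : bool := ~~ (0 < j <= c)%N.
Definition state (c : nat) y : Prop :=
  (forall j, ~~ active c j -> y j = sX j) /\
  (forall j, active c j -> (height r0 (sX j) < top_height r0 (y j))%N /\
     forall i, active c i ->
       ~~ (height r0 (sX j) < height r0 (sX i) < top_height r0 (y j))%N).

Lemma state0 y : state 0 y -> y = upper_left.
Proof.
move=> [_ h]; apply/permP => j; rewrite upper_leftE.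
have act k : active 0 k by rewrite /active; lia.
have [h1 h2] := h j (act j).
(* The X one row above that of column [j] is active too, so the point cannot lie higher than its
   row. *)
apply: (@top_height_inj _ r0); have := h2 ((sX^-1)%g (ordS (sX j))) (act _).
rewrite permKV height_ordS; have := height_lt r0 (y j); have := height_lt r0 (sX j).
have := height_ordS r0 (sX j).
have [[-> ->]|[-> ?]] := top_heightP r0 (ordS (sX j));
  have [[e e']|[e' ?]] := top_heightP r0 (y j); rewrite ?height0 e' in h1 *;
  by case: eqP => ?; lia.
Qed.

(** The rectangle starts at the X of column [k] and ends at the lowest active point above it.
    Minimality is part of the conclusion because uniqueness of the chain relies on it as well. *)
Lemma state_step (c : nat) y k : k = c.+1 :> nat -> state c.+1 y ->
  exists b, [/\ active c.+1 b, (height r0 (sX k) < top_height r0 (y b))%N,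
    forall j, active c.+1 j -> (height r0 (sX k) < top_height r0 (y j))%N ->
      (top_height r0 (y b) <= top_height r0 (y j))%N,
    counted_at sX k (y, k, b) & state c (rect_end (y, k, b))].
Proof.
move=> kc [h1 h2].
have kin : ~~ active c.+1 k by rewrite /active; lia.
have yk := h1 k kin.
have act0 : active c.+1 ord0 by [].
have actV j : active c.+1 j -> active c.+1 ((sX^-1)%g (y j)).
  apply: contraLR => h; have := h1 _ h; rewrite permKV => /perm_inj e.
  by rewrite -e.
pose P b := active c.+1 b && (height r0 (sX k) < top_height r0 (y b))%N.
(* The point on [r0] has maximal top height and lies in an active column, so there is a candidate to
   minimise over. *)
have Pb0 : P ((y^-1)%g r0).
  rewrite /P permKV /top_height eqxx height_lt andbT.
  apply: contraLR act0 => h; have := h1 _ h; rewrite permKV => /perm_inj e.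
  by rewrite negbK e; move: h; rewrite negbK.
have [b /andP[ab hb] bmin] := arg_minnP (fun b => top_height r0 (y b)) Pb0.
have {}bmin j : active c.+1 j -> (height r0 (sX k) < top_height r0 (y j))%N ->
    (top_height r0 (y b) <= top_height r0 (y j))%N.
  by move=> aj hj; apply: bmin; rewrite /P aj.
exists b.
have kb : k != b by apply: contraNneq kin => ->.
have ynb : sX k != y b by rewrite -yk (inj_eq perm_inj).
have hk : (0 < height r0 (sX k))%N.
  by rewrite lt0n height_eq0 (inj_eq perm_inj) -(inj_eq val_inj) /= kc.
have actS j : active c j = (j == k) || active c.+1 j.
  by rewrite /active -(inj_eq val_inj) /= kc; lia.
(* The row of an active X carries an active point, so an active X between that of [k] and the point
   of [b] would provide a lower candidate. *)
have mono j : active c.+1 j -> (height r0 (sX j) < top_height r0 (y b))%N ->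
    (height r0 (sX j) < height r0 (sX k))%N.
  move=> aj hj; rewrite ltnNge; apply/negP => hkj.
  pose i := (y^-1)%g (sX j); have yi : y i = sX j by rewrite permKV.
  have ai : active c.+1 i.
    by apply: contraLR aj => ai; move: (h1 _ ai); rewrite yi => /perm_inj ->.
  have jk : height r0 (sX j) != height r0 (sX k).
    by rewrite (inj_eq (@height_inj _ r0)) (inj_eq perm_inj); apply: contraTneq aj => ->.
  have := bmin i ai; rewrite yi.
  move/eqP: jk; have [[e _]|[-> _]] := top_heightP r0 (sX j); last by lia.
  by move: hkj; rewrite e height0; lia.
have hbk := mono b ab (h2 b ab).1.
(* As [b] is 0 or larger than [k], the rectangle meets none of the columns [1], ..., [c]. *)
have inact j : cyc_in k b j -> j != k -> active c.+1 j.
  move: ab; rewrite /active cyc_inE -(inj_eq val_inj) /= kc => + + /eqP.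
  by case: (leqP c.+1 b); lia.
have rows := cyc_in_top _ ynb hb.
split=> //.
  apply/and3P; split=> //; apply/forallP => j; last first.
    rewrite /rect_dom yk rows; have [->|jk] := eqVneq j k.
      by rewrite cyc_in_left // leqnn hb.
    rewrite eqb0; apply/negP => /andP[/inact/(_ jk) aj /andP[hj /(mono j aj)]].
    by rewrite ltnNge hj.
  apply/negP => /andP[ck cy]; have [_ jb kj] := cyc_open_neq (etrans (cyc_open_rot _ _ _) ck).
  have jk : j != k by apply: contraTneq ck => ->; rewrite cyc_open_l.
  have yjk : y j != y k by rewrite (inj_eq perm_inj).
  move: ck cy; rewrite !cyc_open_in // yk rows => /inact/(_ jk) aj /andP[hj].
  rewrite -(inj_eq (@height_inj _ r0)) yk in yjk.
  have := bmin j aj.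
  have [[e _]|[-> ?]] := top_heightP r0 (y j); first by rewrite e height0 in hj; lia.
  by move: yjk => /eqP; lia.
rewrite /state /rect_end /=; split=> j.
  rewrite actS negb_or => /andP[jk aj]; rewrite permM tpermD ?h1 1?eq_sym //.
  by apply: contraNneq aj => ->.
rewrite actS => /orP[/eqP -> {j}|aj].
  rewrite permM tpermL; split=> // i; rewrite actS => /orP[/eqP ->|ai]; first by rewrite ltnn.
  by apply/negP => /andP[h3 /(mono i ai)]; lia.
rewrite permM; have [-> {j aj}|jb] := eqVneq j b.
  rewrite tpermR yk; have -> : top_height r0 (sX k) = height r0 (sX k).
    by rewrite /top_height -height_eq0; case: eqP hk => // ->.
  split=> // i; rewrite actS => /orP[/eqP ->|ai]; first by rewrite ltnn andbF.
  by have := (h2 b ab).2 i ai; lia.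
have jk : j != k by apply: contraTneq aj => ->.
rewrite tpermD 1?eq_sym //; have [h3 h4] := h2 j aj.
split=> // i; rewrite actS => /orP[/eqP ->|]; last exact: h4.
(* If the X of [k] blocked column [j], then the active X in the row of the point of [b] would have
   blocked it already. *)
apply/negP => /andP[h5 h6]; have h7 := bmin j aj h6.
have h8 : top_height r0 (y b) != top_height r0 (y j).
  by rewrite (inj_eq (@top_height_inj _ r0)) (inj_eq perm_inj) eq_sym.
have := h4 _ (actV b ab); rewrite permKV.
have [[_ e]|[e _]] := top_heightP r0 (y b); last by rewrite -e; lia.
have [[_ e']|[e' _]] := top_heightP r0 (y j); first by rewrite e e' eqxx in h8.
by have := height_lt r0 (y j); rewrite -e'; lia.
Qed.

(** [M] is the domain accumulated so far. Any chain that can be completed has the total domain of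
    [link_domain]; this bounds the next rectangle and leaves only the one from [state_step]. *)
Lemma cocycle_state (c : nat) y M : (c <= n)%N -> state c y ->
  link sX y M -> (forall j, M j (sX j) = (c < j)%N) -> cocycle c y = 1.
Proof.
elim: c y M => [|c IH] y M cn st l m; first by rewrite /= (state0 st) eqxx.
pose k : 'I_n.+1 := inord c.+1.
have kc : k = c.+1 :> nat by rewrite inordK.
have [b [ab hb bmin cb stb]] := state_step kc st.
have kin : ~~ active c.+1 k by rewrite /active; lia.
have yk := st.1 k kin.
have ok a b' : counted_at sX k (y, a, b') -> cocycle c (rect_end (y, a, b')) != 0 ->
    a = k /\ b' = b.
  move=> /and3P[neq _ /forallP X] /(cocycle_link (ltnW cn))[M2 l2 m2].
  have l1 := link_trans l (link_trans (link_rect y neq) l2).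
  have D c' j : (rect_dom (y, a, b') c' (sX j) <= (0 < j <= c'))%N.
    rewrite -(link_domain l1) ?leq_add2l.
      by rewrite addnCA leq_addr.
    move=> i; rewrite m m2 (eqP (X i)) -(inj_eq val_inj) /= kc; case: eqP; lia.
  have inC := eqP (X k); rewrite eqxx /rect_dom in inC.
  have /andP[ck rk] : cyc_in a b' k && cyc_in (y a) (y b') (sX k) by case: (_ && _) inC.
  (* Starting further left would cover the row of the X of [k] in column [c], where the total domain
     is zero. *)
  have ak : a = k.
    apply/eqP; apply: contraT => ak; have := D (inord c) k; rewrite /rect_dom rk andbT.
    rewrite inordK ?kc ?ltnn ?andbF; last by apply: leq_trans cn _.
    have -> // : cyc_in a b' (inord c).
    move: ck ak; rewrite !cyc_inE -(inj_eq val_inj) /= inordK ?kc; last exact: leq_trans cn _.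
    by move=> + /eqP; case: (leqP a b') => ?; lia.
  subst a; split=> //; have yb' : sX k != y b' by rewrite -yk (inj_eq perm_inj).
  rewrite yk in rk.
  (* The total domain avoids the row of the X in column 0. *)
  have hb' : (height r0 (sX k) < top_height r0 (y b'))%N.
    apply: cyc_in_base => //; have := D k ord0.
    by rewrite /rect_dom yk ck /=; case: cyc_in.
  (* The total domain avoids column 0, so the rectangle does not wrap around. *)
  have ab' : active c.+1 b'.
    have := D ord0 k; rewrite /rect_dom yk rk andbT cyc_inE kc /= /active.
    move: neq; rewrite /rect_ok -(inj_eq val_inj) /= kc => /eqP ?.
    by case: (leqP c.+1 b'); lia.
  apply/eqP; apply: contraT => bb'.
  have : top_height r0 (y b') != top_height r0 (y b).
    by rewrite (inj_eq (@top_height_inj _ r0)) (inj_eq perm_inj).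
  have h1 := bmin b' ab' hb'; have h2 : (top_height r0 (y b') <= n.+1)%N.
    by have := height_lt r0 (y b'); have [[_ ->]|[-> _]] := top_heightP r0 (y b'); lia.
  move=> /eqP h3.
  (* A taller rectangle would contain, in column [k], the row of the point of [b]. The X of that row
     would then lie in an inactive column, where points and X's agree. *)
  have := D k ((sX^-1)%g (y b)); rewrite permKV /rect_dom ck yk /= (cyc_in_top _ yb' hb').
  have [[_ e]|[e _]] := top_heightP r0 (y b); first by rewrite e in h1 h3; lia.
  rewrite -e (_ : (_ <= _ < _)%N); last by lia.
  move=> ib; have := st.1 ((sX^-1)%g (y b)); rewrite permKV.
  have ina : ~~ active c.+1 ((sX^-1)%g (y b)) by rewrite /active -kc; lia.
  by move=> /(_ ina)/perm_inj e'; rewrite e' ab in ina.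
rewrite /= -/k /coboundary (bigD1 k) //= (bigD1 b) //= cb.
have zero a b' : (a, b') != (k, b) ->
    (if counted_at sX k (y, a, b') then cocycle c (rect_end (y, a, b')) else 0) = 0.
  move=> neq; case: ifP => // /ok h; apply/eqP; apply: contraNT neq => /h[-> ->].
  exact: eqxx.
rewrite [X in _ + X + _]big1 ?addr0 => [|b' b'b]; last first.
  by apply: zero; rewrite xpair_eqE negb_and b'b orbT.
rewrite [X in _ + X]big1 ?addr0 => [|a ak]; last first.
  by rewrite big1 // => b' _; apply: zero; rewrite xpair_eqE negb_and ak.
have /and3P[kb _ /forallP X] := cb.
apply: (IH _ _ (ltnW cn) stb (link_trans l (link_rect y kb))) => j.
rewrite m (eqP (X j)) -(inj_eq val_inj) /= kc; case: eqP; lia.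
Qed.

Lemma cocycle_xminus : cocycle n sX = 1.
Proof.
apply: (@cocycle_state _ _ (fun _ _ => 0%N)) => // [|j]; last first.
  by rewrite ltnNge -ltnS ltn_ord.
have actn j : active n j = (j == ord0).
  by rewrite /active -(inj_eq val_inj) /=; have := ltn_ord j; lia.
split=> // j; rewrite actn => /eqP ->; rewrite /top_height eqxx height_lt; split=> // i.
by rewrite actn => /eqP ->; rewrite ltnn.
Qed.

End Links.

(** * Rotation and reduction modulo 2 *)

Section Rotation.

Variable n : nat.
Implicit Types (a b c k : 'I_n) (x : gen n) (sX : {perm 'I_n}).

(** Under a half turn grid circles are negated modulo [n], while the square between circles [k] and
    [k + 1] gets the number [n - 1 - k]; hence two different permutations. *)
Definition neg_ord k : 'I_n := ordS (rev_ord k).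

Lemma neg_ord_val k : neg_ord k = (if k == 0 :> nat then 0 else n - k)%N :> nat.
Proof.
rewrite ordS_val /=; have := ltn_ord k => ?.
by case: (eqVneq (k : nat) 0%N) => ?; case: eqP; lia.
Qed.

Lemma neg_ordK : involutive neg_ord.
Proof.
move=> k; apply: ord_inj; rewrite !neg_ord_val; have := ltn_ord k => ?.
by case: (eqVneq (k : nat) 0%N) => ?; case: eqP; lia.
Qed.

Definition neg_perm : {perm 'I_n} := perm (inv_inj neg_ordK).
Definition rev_perm : {perm 'I_n} := perm (@rev_ord_inj n).

Lemma neg_permE k : neg_perm k = neg_ord k.
Proof. exact: permE. Qed.

Lemma neg_permK k : neg_perm (neg_perm k) = k.
Proof. by rewrite !neg_permE neg_ordK. Qed.

Lemma rev_permE k : rev_perm k = rev_ord k.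
Proof. exact: permE. Qed.

Lemma rev_permK k : rev_perm (rev_perm k) = k.
Proof. by rewrite !rev_permE rev_ordK. Qed.

Lemma cyc_in_neg a b c :
  cyc_in (neg_perm b) (neg_perm a) (rev_perm c) = cyc_in a b c.
Proof.
rewrite !neg_permE rev_permE !cyc_inE !neg_ord_val /=.
have := ltn_ord a; have := ltn_ord b; have := ltn_ord c => ? ? ?.
case: (eqVneq (a : nat) 0%N) => ?; case: (eqVneq (b : nat) 0%N) => ?;
  by case: (leqP a b) => ? /=; do ?case: ifP => ?; lia.
Qed.

Lemma cyc_open_neg a b c :
  cyc_open (neg_perm b) (neg_perm a) (neg_perm c) = cyc_open a b c.
Proof.
rewrite !neg_permE !cyc_openE !neg_ord_val.
have := ltn_ord a; have := ltn_ord b; have := ltn_ord c => ? ? ?.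
case: (eqVneq (a : nat) 0%N) => ?; case: (eqVneq (b : nat) 0%N) => ?;
  case: (eqVneq (c : nat) 0%N) => ?;
  by case: (leqP a b) => ? /=; do ?case: ifP => ?; lia.
Qed.

(* Rotation of the torus by 180 degrees, acting on generators through lattice
   points and on X markings through squares. *)
Definition rot_gen x : gen n := (neg_perm * x * neg_perm)%g.
Definition rot_marks sX : {perm 'I_n} := (rev_perm * sX * rev_perm)%g.

Lemma rot_genE x k : rot_gen x (neg_perm k) = neg_perm (x k).
Proof. by rewrite !permM neg_permK. Qed.

Lemma rot_marksE sX k : rot_marks sX (rev_perm k) = rev_perm (sX k).
Proof. by rewrite !permM rev_permK. Qed.

(** A half turn takes upper right to lower left corners; the right side is [xminus] of the rotated
    marks. *)
Lemma rot_xplus sX : rot_gen (xplus sX) = rot_marks sX.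
Proof.
apply/permP => k; rewrite !permM !rev_permE !neg_permE permE /xplus_fun /neg_ord ordSK.
apply: ord_inj; move: (sX _) => j; rewrite -/(neg_ord (ordS j)) neg_ord_val ordS_val /=.
by have := ltn_ord j; case: (eqVneq j.+1 n) => ?; case: eqP; lia.
Qed.

Lemma counted_rot sX x a b :
  counted (rot_marks sX) (rot_gen x, neg_perm b, neg_perm a) = counted sX (x, a, b).
Proof.
rewrite /counted /rect_ok /= (inj_eq perm_inj) eq_sym !rot_genE; congr [&& _, _ & _].
  apply/forallP/forallP => h c.
    by have := h (neg_perm c); rewrite rot_genE !cyc_open_neg.
  by have := h (neg_perm c); rewrite -[c in X in _ -> X]neg_permK rot_genE !cyc_open_neg.
apply/forallP/forallP => h c; have := h (rev_perm c).
  by rewrite /rect_dom !rot_genE rot_marksE !cyc_in_neg.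
by rewrite -[c in X in _ -> X]rev_permK /rect_dom !rot_genE rot_marksE !cyc_in_neg.
Qed.

Lemma rect_end_rot x a b :
  rect_end (rot_gen x, neg_perm b, neg_perm a) = rot_gen (rect_end (x, a, b)).
Proof.
apply/permP => k; rewrite -[k]neg_permK rot_genE /rect_end /= !permM.
by rewrite tpermC -(inj_tperm _ _ _ perm_inj) neg_permK.
Qed.

Lemma coboundary_rot sX phi x :
  coboundary (counted sX) (phi \o rot_gen) x =
  coboundary (counted (rot_marks sX)) phi (rot_gen x).
Proof.
rewrite /coboundary exchange_big [RHS](reindex_inj (@perm_inj _ neg_perm)) /=.
apply: eq_bigr => a _; rewrite [RHS](reindex_inj (@perm_inj _ neg_perm)) /=.
by apply: eq_bigr => b _; rewrite counted_rot rect_end_rot.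
Qed.

End Rotation.

(** Send every [U_j] to 1, reduce modulo 2 and pair with [phi]. Signs become 1; a boundary pairs to
    zero by the cocycle condition, while the given element pairs to [phi x = 1]. *)
Lemma cocycle_not_boundary n (sX sO : {perm 'I_n}) (S : rect n -> int)
    (phi : gen n -> 'F_2) (x : gen n) (i : 'I_n) (d : nat) :
  (forall r, rect_ok r -> S r = 1 \/ S r = -1) ->
  (forall y, coboundary (counted sX) phi y = 0) -> phi x = 1 ->
  ~ is_boundary sX sO S (genmul ('X_i ^+ d) x).
Proof.
move=> Sunit cocy phix [c dc].
pose ev : {rmorphism ring_U n -> 'F_2} := mmap (intr : int -> 'F_2) (fun=> 1).
have evX j : ev 'X_j = 1 by rewrite /= mmapX mmap1U.
have evS r : rect_ok r -> ev ((S r)%:~R * rect_weight sO r) = 1.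
  move=> /Sunit Sr; rewrite rmorphM /rect_weight rmorph_prod big1 ?mulr1.
    by rewrite rmorph_int; case: Sr => ->; rewrite ?rmorphN1 //; apply/eqP.
  by move=> j _; rewrite rmorphXn evX expr1n.
have : \sum_y phi y * ev (dCL sX sO S c y) = 1.
  rewrite dc (bigD1 x) //= !ffunE eqxx phix rmorphXn evX expr1n mulr1 big1 ?addr0 //.
  by move=> y yx; rewrite !ffunE (negbTE yx) rmorph0 mulr0.
suff -> : \sum_y phi y * ev (dCL sX sO S c y) = 0 by move/eqP; rewrite eq_sym oner_eq0.
transitivity (\sum_(r | counted sX r) ev (c (rect_start r)) * phi (rect_end r)).
  rewrite [RHS](partition_big (@rect_end n) xpredT) //=; apply: eq_bigr => y _.
  rewrite ffunE rmorph_sum mulr_sumr; apply: eq_bigr => r /andP[/and3P[ok _ _] /eqP <-].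
  by rewrite rmorphM (evS r ok) mulr1 mulrC.
transitivity (\sum_y ev (c y) * coboundary (counted sX) phi y); last first.
  by rewrite big1 // => y _; rewrite cocy mulr0.
pose T r := if counted sX r then ev (c (rect_start r)) * phi (rect_end r) else 0.
transitivity (\sum_y \sum_a \sum_b T (y, a, b)).
  rewrite big_mkcond; under [RHS]eq_bigr => y _ do rewrite pair_bigA.
  by rewrite pair_bigA (reindex (fun q => (q.1, q.2.1, q.2.2))) //=;
    exists (fun r => (r.1.1, (r.1.2, r.2))); [move=> [? []] | move=> [[]]].
apply: eq_bigr => y _; rewrite mulr_sumr; apply: eq_bigr => a _; rewrite mulr_sumr.
by apply: eq_bigr => b _; rewrite /T; case: ifP; rewrite ?mulr0.
Qed.

Theorem theorem7p3 (n : nat) (sX sO : {perm 'I_n})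
    (HXO : forall c : 'I_n, sX c != sO c)
    (S : rect n -> int) (HS : sign_assignment S) :
  forall (i : 'I_n) (d : nat),
    ~ is_boundary sX sO S (genmul ('X_i ^+ d) (xplus sX)) /\
    ~ is_boundary sX sO S (genmul ('X_i ^+ d) (xminus sX)).
Proof.
case: n sX sO HXO S HS => [|n] sX sO HXO S [Sunit _ _ _] i d; first by case: i.
(* In grid number 1 the X and the O would share the only square. *)
have n0 : (0 < n)%N.
  by case: n sX sO HXO {S Sunit i} => // sX sO /(_ ord0); rewrite !ord1.
split; last first.
  apply: (cocycle_not_boundary Sunit (fun y => cocycleP sX n y n0)).
  exact: cocycle_xminus.
apply: (@cocycle_not_boundary _ _ _ _ (cocycle (rot_marks sX) n \o @rot_gen n.+1)) => //.
  by move=> y; rewrite coboundary_rot cocycleP.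
by rewrite /= rot_xplus cocycle_xminus.
Qed.
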